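(* Let $d\geq 2$ be an integer, let $\lambda=(\lambda_1,\ldots,\lambda_\ell)$ and $\mu=(\mu_1,\ldots,\mu_\ell)$ be two $d$-ary partitions with $\ell$ parts each, and let $1\leq j\leq \ell-1$ be an integer. If $\mathcal E_j(\lambda)=\mathcal E_j(\mu)$ and $\lambda_{i_1}\cdots\lambda_{i_j}=\mu_{i_1}\cdots\mu_{i_j}$ for all $1\leq i_1<\cdots<i_j\leq \ell$, then $\lambda=\mu$.
   Context: A partition $\lambda=(\lambda_1,\ldots,\lambda_\ell)$ is a finite non-increasing sequence $\lambda_1\geq\cdots\geq\lambda_\ell\geq1$ of positive integers; $\ell$ is its length. For an integer $d\geq2$, $\lambda$ is $d$-ary if every $\lambda_i$ is a power of $d$ (including $d^0=1$). For $1\leq j\leq \ell$, the elementary symmetric partition $\mathcal E_j(\lambda)$ is the partition whose parts are the products $\lambda_{i_1}\cdots\lambda_{i_j}$ over all $1\leq i_1<\cdots<i_j\leq\ell$ (counted with multiplicity, arranged in non-increasing order). *)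

(* Defs.v *)
From mathcomp Require Import all_boot.

Set Implicit Arguments.
Unset Strict Implicit.
Unset Printing Implicit Defensive.

Definition is_partition (s : seq nat) : bool :=
  sorted geq s && all (fun x => 0 < x) s.

Definition dary (d : nat) (s : seq nat) : Prop :=
  forall x, x \in s -> exists k, x = d ^ k.

(* Index tuples i_1 < ... < i_j are encoded as the j-element sets of (0-based)
   indices; the product over such a set is the product of the chosen parts. *)
Definition subprod (s : seq nat) (l : nat) (A : {set 'I_l}) : nat :=
  \prod_(i in A) nth 0 s i.

(* The image is taken as a sequence, so equal products are kept with their
   multiplicity. *)
Definition elem_sym_partition (j : nat) (s : seq nat) : seq nat :=
  sort geq [seq subprod s A | A : {set 'I_(size s)}
                                in [pred A : {set _} | #|A| == j]].

Lemma elem_sym_partitionP j s :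
  is_partition s -> is_partition (elem_sym_partition j s).
Proof.
case/andP=> _ /allP s_gt0; apply/andP; split.
  by apply: sort_sorted => m n; apply: leq_total.
rewrite all_sort; apply/allP => _ /mapP[A _ ->].
by apply: prodn_cond_gt0 => i _; apply/s_gt0/mem_nth.
Qed.

(* Main.v *)
(** Write [B] for a set of [j - 1] indices avoiding [a] and [b]. Comparing the
    products over [a |: B] and [b |: B] shows that the ratio of the two families
    is the same at [a] and at [b]. A common ratio below 1 would make every
    [j]-fold product of the first family strictly smaller. *)
Require Import Defs.
From mathcomp Require Import all_boot.

(** The subsets of [B] with [k] elements are counted by a binomial coefficient, which is
    positive. *)
Lemma exists_subset_card (T : finType) (B : {set T}) (k : nat) :
  k <= #|B| -> exists2 A : {set T}, A \subset B & #|A| = k.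
Proof.
rewrite -bin_gt0 -cards_draws => /card_gt0P[A].
by rewrite inE => /andP[sAB /eqP cA]; exists A.
Qed.

Lemma ltn_prod_set (T : finType) (A : {set T}) (f g : T -> nat) :
    0 < #|A| -> (forall i, f i < g i) ->
  \prod_(i in A) f i < \prod_(i in A) g i.
Proof.
case/card_gt0P=> a aA ltfg; rewrite !(bigD1 a aA) /=.
have le_rest : \prod_(i in A | i != a) f i <= \prod_(i in A | i != a) g i.
  by apply: leq_prod => i _; apply: ltnW.
apply: (leq_ltn_trans (leq_mul (leqnn _) le_rest)).
(* Strictness at [a] survives because the remaining factors [g i] exceed [f i] and so are
   positive. *)
rewrite ltn_pmul2r ?ltfg // prodn_cond_gt0 // => i _.
exact: leq_ltn_trans (ltfg i).
Qed.

Section ProductsOverSubsets.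

Variables (T : finType) (j : nat).
Hypotheses (j_gt0 : 0 < j) (j_lt : j < #|T|).

(** The equality of ratios is cross-multiplied to stay in [nat]. *)
Lemma subset_prods_ratio (f g : T -> nat) (a b : T) :
    (forall i, 0 < f i) -> (forall i, 0 < g i) ->
    (forall A : {set T}, #|A| = j ->
       \prod_(i in A) f i = \prod_(i in A) g i) ->
  f a * g b = f b * g a.
Proof.
move=> f_gt0 g_gt0 eq_prod; have [-> // | neq_ab] := eqVneq a b.
(* The complement of [{a, b}] has [#|T| - 2 >= j - 1] elements because [j < #|T|]. *)
have [B sB cB] : exists2 B : {set T}, B \subset ~: [set a; b] & #|B| = j.-1.
  apply: exists_subset_card.
  by have := leq_sub2r 2 j_lt; rewrite cardsCs setCK cards2 neq_ab subSS subn1.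
have eq_prodU c : c \in [set a; b] ->
    f c * \prod_(i in B) f i = g c * \prod_(i in B) g i.
  move=> c_ab; have cNB : c \notin B.
    by apply/negP => /(subsetP sB); rewrite inE c_ab.
  by rewrite -!big_setU1 //= eq_prod // cardsU1 cNB cB add1n prednK.
have /eq_prodU eq_a : a \in [set a; b] by rewrite set21.
have /eq_prodU eq_b : b \in [set a; b] by rewrite set22.
have PQ_gt0 : 0 < (\prod_(i in B) f i) * (\prod_(i in B) g i).
  by rewrite muln_gt0 !prodn_cond_gt0.
(* With P and Q the products of [f] and [g] over [B], both sides times PQ regroup into (f a P)(g b
   Q) = (g a Q)(f b P). *)
apply/eqP; rewrite -(eqn_pmul2r PQ_gt0) mulnACA eq_a -eq_b; apply/eqP.
by rewrite mulnC mulnACA.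
Qed.

Lemma subset_prods_leq (f g : T -> nat) (a : T) :
    (forall i, 0 < f i) -> (forall i, 0 < g i) ->
    (forall A : {set T}, #|A| = j ->
       \prod_(i in A) f i = \prod_(i in A) g i) ->
  g a <= f a.
Proof.
move=> f_gt0 g_gt0 eq_prod; rewrite leqNgt; apply/negP => lt_a.
have lt_fg b : f b < g b.
  (* The ratio identity gives [f b * g a = f a * g b < g a * g b]. *)
  rewrite -(ltn_pmul2r (g_gt0 a)) -(subset_prods_ratio f g a b) //.
  by rewrite mulnC ltn_pmul2l.
have [A _ cA] : exists2 A : {set T}, A \subset setT & #|A| = j.
  by apply: exists_subset_card; rewrite cardsT ltnW.
have := ltn_prod_set T A f g _ lt_fg.
by rewrite cA eq_prod // ltnn => /(_ j_gt0).
Qed.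

End ProductsOverSubsets.

Theorem theorem4p2 (d l j : nat) (lambda mu : seq nat)
    (hd : 2 <= d)
    (hlambda : is_partition lambda) (hmu : is_partition mu)
    (hlambda_dary : dary d lambda) (hmu_dary : dary d mu)
    (hlambda_size : size lambda = l) (hmu_size : size mu = l)
    (hj : 1 <= j <= l - 1)
    (hE : elem_sym_partition j lambda = elem_sym_partition j mu)
    (hprod : forall A : {set 'I_l}, #|A| = j ->
       subprod lambda A = subprod mu A) :
  lambda = mu.
Proof.
have nth_gt0 s (i : 'I_l) : is_partition s -> size s = l -> 0 < nth 0 s i.
  by case/andP=> _ /allP s_gt0 sz_s; apply/s_gt0/mem_nth; rewrite sz_s.
have /andP[j_gt0 j_le] := hj.
have j_lt : j < #|'I_l|.
  (* Subtraction is truncated: for [l = 0] the bound reads [j <= 0], against [0 < j]. *)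
  by rewrite card_ord; case: (l) j_le => [|n]; [case: (j) j_gt0 | rewrite subn1].
apply: (@eq_from_nth _ 0) => [|i]; first by rewrite hmu_size.
rewrite hlambda_size => lt_il; pose k := Ordinal lt_il.
(* The hypotheses are symmetric in the two families, so the one-sided bound applies in both
   directions. *)
apply/eqP; rewrite eqn_leq; apply/andP; split.
  apply: (subset_prods_leq _ j j_gt0 j_lt
    (fun k : 'I_l => nth 0 mu k) (fun k => nth 0 lambda k) k) => [?|?|A cA].
  - exact: nth_gt0.
  - exact: nth_gt0.
  - exact/esym/hprod.
apply: (subset_prods_leq _ j j_gt0 j_lt
  (fun k : 'I_l => nth 0 lambda k) (fun k => nth 0 mu k) k) => [?|?|A cA].
- exact: nth_gt0.
- exact: nth_gt0.
- exact: hprod.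
Qed.
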